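(* Let $\Omega$ be a nonempty open subset of $\mathbb{R}^N$ of finite measure. Then $\mathrm{NLBV}(\Omega)=\mathrm{BV}(\Omega)$ with equivalence of norms.
   Context: For $\phi\in\mathcal{C}^1_c(\Omega\times\Omega;\mathbb{R}^N)$ put $$\mathrm{div}_1(\phi)(x):=\int_\Omega\mathrm{div}_x\left[\phi(y,x)-\phi(x,y)\right]\mathrm{d}y,\quad x\in\Omega.$$ For $u\in L^1(\Omega)$, $$\mathrm{NLTV}(u):=\sup\left\{\int_\Omega u(x)\,\mathrm{div}_1(\phi)(x)\,\mathrm{d}x:\ \phi\in\mathcal{C}^1_c(\Omega\times\Omega;\mathbb{R}^N),\ \|\phi\|_\infty\le1\right\},$$ where $\|\phi\|_\infty$ is the supremum of the pointwise Euclidean norm. $\mathrm{NLBV}(\Omega):=\{u\in L^1(\Omega):\mathrm{NLTV}(u)<+\infty\}$ with norm $\|u\|_{L^1(\Omega)}+\mathrm{NLTV}(u)$. $\mathrm{BV}(\Omega)$ is the classical space of functions of bounded variation with norm $\|u\|_{L^1(\Omega)}+\mathrm{TV}(u)$. *)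

(* Defs.v *)
From HB Require Import structures.
From mathcomp Require Import all_boot all_order all_algebra.
From mathcomp Require Import all_classical all_reals all_analysis.

Set Implicit Arguments.
Unset Strict Implicit.
Unset Printing Implicit Defensive.
Import Order.TTheory GRing.Theory Num.Theory.
Import numFieldNormedType.Exports.
Local Open Scope classical_set_scope.
Local Open Scope ring_scope.

(* MathComp-Analysis has a topology and a normed module structure on 'rV[R]_n,
   but no measurable structure: equip it with the product sigma-algebra, as the
   library does for n.-tuple T.  For T = R this is the Borel sigma-algebra. *)

Definition measure_rV_display : measure_display -> measure_display.
Proof. exact. Qed.

Section measurable_rV.
Context {d} {T : measurableType d}.
Variable n : nat.

Let coors : 'I_n -> 'rV[T]_n -> T := fun i v => v ord0 i.

Let rV_set0 : g_sigma_preimage coors set0.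
Proof. exact: sigma_algebra0. Qed.

Let rV_setC A : g_sigma_preimage coors A -> g_sigma_preimage coors (~` A).
Proof. exact: sigma_algebraC. Qed.

Let rV_bigcup (F : _^nat) : (forall i, g_sigma_preimage coors (F i)) ->
  g_sigma_preimage coors (\bigcup_i (F i)).
Proof. exact: sigma_algebra_bigcup. Qed.

HB.instance Definition _ := @isMeasurable.Build (measure_rV_display d)
  'rV[T]_n (g_sigma_preimage coors) rV_set0 rV_setC rV_bigcup.

End measurable_rV.

Lemma measurable_coord d (T : measurableType d) n (i : 'I_n) :
  measurable_fun [set: 'rV[T]_n] (fun v : 'rV[T]_n => v ord0 i).
Proof.
move=> _ Y mY; rewrite setTI; apply: sub_sigma_algebra => /=.
rewrite -bigcup_seq/=; exists i => /=; first by rewrite mem_index_enum.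
by exists Y => //; rewrite setTI.
Qed.

Lemma measurable_fun_rV d1 d2 (T1 : measurableType d1) (T2 : measurableType d2)
    n (f : T1 -> 'rV[T2]_n) :
  (forall i, measurable_fun [set: T1] (fun x => f x ord0 i)) ->
  measurable_fun [set: T1] f.
Proof.
move=> mf _ A mA; rewrite setTI.
have sub : g_sigma_preimage (fun i => (fun v : 'rV[T2]_n => v ord0 i) \o f)
    `<=` measurable.
  apply: smallest_sub; first exact: sigma_algebra_measurable.
  rewrite -bigcup_seq; apply: bigcup_sub => i _ B [C mC <-].
  exact: mf.
apply: sub; rewrite g_sigma_preimage_comp.
by exists A => //; rewrite setTI.
Qed.

Section lebesgue_rV.
Context {R : realType}.

Definition rVcons n (p : R * 'rV[R]_n) : 'rV[R]_n.+1 :=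
  \row_i (if unlift ord0 i is Some j then p.2 ord0 j else p.1).

Definition rVuncons n (v : 'rV[R]_n.+1) : R * 'rV[R]_n :=
  (v ord0 ord0, \row_i v ord0 (lift ord0 i)).

Lemma rVcons0 n p : @rVcons n p ord0 ord0 = p.1.
Proof. by rewrite mxE unlift_none. Qed.

Lemma rVconsS n p i : @rVcons n p ord0 (lift ord0 i) = p.2 ord0 i.
Proof. by rewrite mxE liftK. Qed.

Lemma rVunconsK n : cancel (@rVuncons n) (@rVcons n).
Proof.
move=> v; apply/rowP => i; case: (unliftP ord0 i) => [j ->|->].
  by rewrite rVconsS mxE.
by rewrite rVcons0.
Qed.

Lemma rVconsK n : cancel (@rVcons n) (@rVuncons n).
Proof.
move=> [x v]; rewrite /rVuncons rVcons0; congr pair.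
by apply/rowP => i; rewrite mxE rVconsS.
Qed.

Lemma measurable_rVcons n : measurable_fun setT (@rVcons n).
Proof.
apply: measurable_fun_rV => i; case: (unliftP ord0 i) => [j ->|->].
  under eq_fun do rewrite rVconsS.
  exact: (measurableT_comp (measurable_coord (T := R) j) measurable_snd).
by under eq_fun do rewrite rVcons0; exact: measurable_fst.
Qed.

Lemma measurable_rVuncons n : measurable_fun setT (@rVuncons n).
Proof.
apply/measurable_fun_pairP; split; first exact: measurable_coord.
apply: measurable_fun_rV => i; rewrite /rVuncons /=.
under eq_fun do rewrite mxE.
exact: measurable_coord.
Qed.

Section step.
Variables (n : nat) (m : {sigma_finite_measure set 'rV[R]_n -> \bar R}).

Definition lebesgue_rVS : set 'rV[R]_n.+1 -> \bar R :=
  pushforward (@lebesgue_measure R \x m)%E (@rVcons n).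

Let mpre A : measurable A -> measurable (@rVcons n @^-1` A).
Proof.
by move=> mA; rewrite -[X in measurable X]setTI; exact: measurable_rVcons.
Qed.

Let lebesgue_rVS0 : lebesgue_rVS set0 = 0%E.
Proof. by rewrite /lebesgue_rVS /pushforward preimage_set0 measure0. Qed.

Let lebesgue_rVS_ge0 A : (0 <= lebesgue_rVS A)%E.
Proof. by rewrite /lebesgue_rVS /pushforward; exact: measure_ge0. Qed.

Let lebesgue_rVS_sigma_additive : semi_sigma_additive lebesgue_rVS.
Proof.
move=> F mF tF mUF; rewrite /lebesgue_rVS /pushforward preimage_bigcup.
apply: measure_semi_sigma_additive.
- by move=> k; exact: mpre.
- apply/trivIsetP => /= i j _ _ ij; rewrite -preimage_setI.
  by move/trivIsetP : tF => /(_ _ _ _ _ ij) ->//; rewrite preimage_set0.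
- by rewrite -preimage_bigcup; exact: mpre.
Qed.

HB.instance Definition _ := isMeasure.Build _ _ _ lebesgue_rVS
  lebesgue_rVS0 lebesgue_rVS_ge0 lebesgue_rVS_sigma_additive.

(* Canonical inference only finds a sigma-finite structure on products of
   subprobabilities, hence the direct proof. *)
Let lebesgue_rVS_sigma_finite : sigma_finite setT lebesgue_rVS.
Proof.
have /sigma_finiteP[F [TF ndF Foo]] := sigma_finiteT (@lebesgue_measure R).
have /sigma_finiteP[G [TG ndG Goo]] := sigma_finiteT m.
exists (fun k => @rVuncons n @^-1` (F k `*` G k)).
  rewrite -preimage_bigcup (_ : \bigcup_k _ = setT) ?preimage_setT //.
  apply/seteqP; split=> // -[x v] _.
  have [j _ Fx] : (\bigcup_k F k) x by rewrite -TF.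
  have [k _ Gv] : (\bigcup_k G k) v by rewrite -TG.
  exists (maxn j k) => //; split=> /=.
    by move: x Fx; exact/subsetPset/ndF/leq_maxl.
  by move: v Gv; exact/subsetPset/ndG/leq_maxr.
move=> k; have [mF Fk] := Foo k; have [mG Gk] := Goo k; split.
  rewrite -[X in measurable X]setTI; apply: measurable_rVuncons => //.
  exact: measurableX.
rewrite /lebesgue_rVS /pushforward -comp_preimage (_ : _ \o _ = id); last first.
  by apply/funext => p; rewrite /= rVconsK.
by rewrite preimage_id product_measure1E// lte_mul_pinfty// ge0_fin_numE.
Qed.

HB.instance Definition _ := Measure_isSigmaFinite.Build _ _ _ lebesgue_rVS
  lebesgue_rVS_sigma_finite.

End step.

(* N-dimensional Lebesgue measure, built from the one-dimensional one by
   lambda^(n+1) = lambda \x lambda^n; see lebesgue_rV_box. *)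
Fixpoint lebesgue_rV n : {sigma_finite_measure set 'rV[R]_n -> \bar R} :=
  match n with
  | 0 => \d_ (0 : 'rV[R]_0)
  | n.+1 => lebesgue_rVS (lebesgue_rV n)
  end.

Lemma measurable_box n (A : 'I_n -> set R) :
  (forall i, measurable (A i)) ->
  measurable [set v : 'rV[R]_n | forall i, A i (v ord0 i)].
Proof.
move=> mA.
rewrite (_ : [set _ | _] =
  \bigcap_(i in [set: 'I_n]) (fun v : 'rV[R]_n => v ord0 i) @^-1` A i); last first.
  by apply/seteqP; split=> [v vA i _|v vA i]; exact: vA.
apply: fin_bigcap_measurable => // i _.
by rewrite -[X in measurable X]setTI; exact: measurable_coord.
Qed.

Lemma lebesgue_rV_box n (A : 'I_n -> set R) : (forall i, measurable (A i)) ->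
  lebesgue_rV n [set v | forall i, A i (v ord0 i)] =
  (\prod_(i < n) lebesgue_measure (A i))%E.
Proof.
elim: n A => [|n IH] A mA.
  rewrite big_ord0 /= /dirac indicE mem_set //.
  by case.
rewrite big_ord_recl -IH //= /lebesgue_rVS /pushforward.
rewrite -product_measure1E; [|exact: mA|
  exact: (measurable_box (fun i => mA (lift ord0 i)))].
congr (_ _); apply/seteqP; split=> [[x v] /= vA|[x v] [/= Ax vA] i].
  split=> [|i] /=; first by have := vA ord0; rewrite rVcons0.
  by have := vA (lift ord0 i); rewrite rVconsS.
by case: (unliftP ord0 i) => [j ->|->]; rewrite ?rVconsS ?rVcons0.
Qed.

End lebesgue_rV.

Arguments lebesgue_rV : clear implicits.

Definition suppt (K : numFieldType) (V W : normedModType K) (f : V -> W) : set V :=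
  closure [set x | f x != 0].

(* C^1_c(U; W) for V and W finite-dimensional and U open.  Test functions are
   total, and vanish outside U because their support is contained in U.  As V
   is finite-dimensional, the differential of f is continuous iff x |-> 'D_v f x
   is continuous for every direction v. *)
Definition C1c (K : numFieldType) (V W : normedModType K) (U : set V)
    (f : V -> W) : Prop :=
  [/\ forall x, U x -> differentiable f x,
      forall v x, U x -> {for x, continuous (fun y => 'D_v f y)},
      compact (suppt f) & suppt f `<=` U].

Section BV.
Context {R : realType} {N : nat}.
Implicit Types (Omega : set 'rV[R]_N) (u : 'rV[R]_N -> R).

(* The library norm on 'rV[R]_N is the max norm. *)
Definition enorm (v : 'rV[R]_N) : R := Num.sqrt (\sum_i v ord0 i ^+ 2).

Definition supnorm (V : Type) (U : set V) (f : V -> 'rV[R]_N) : \bar R :=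
  ereal_sup [set (enorm (f z))%:E | z in U].

Definition div (f : 'rV[R]_N -> 'rV[R]_N) (x : 'rV[R]_N) : R :=
  \sum_(i < N) 'D_(delta_mx ord0 i) (fun z => f z ord0 i : R) x.

(* Integrands of the real-valued integrals below are integrable for the
   arguments they are used with, so the junk value of Rintegral is not hit. *)
Definition div1 Omega (phi : 'rV[R]_N * 'rV[R]_N -> 'rV[R]_N) (x : 'rV[R]_N)
    : R :=
  \int[lebesgue_rV R N]_(y in Omega)
    div (fun z => phi (y, z) - phi (z, y)) x.

Definition L1 Omega : set ('rV[R]_N -> R) :=
  [set u | (lebesgue_rV R N).-integrable Omega (EFin \o u)].

Definition L1norm Omega u : \bar R :=
  (\int[lebesgue_rV R N]_(x in Omega) `|u x|%:E)%E.

Definition TV Omega u : \bar R :=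
  ereal_sup [set (\int[lebesgue_rV R N]_(x in Omega) (u x * div psi x))%:E
    | psi in [set psi | C1c Omega psi /\ (supnorm Omega psi <= 1)%E]].

Definition NLTV Omega u : \bar R :=
  ereal_sup [set (\int[lebesgue_rV R N]_(x in Omega) (u x * div1 Omega phi x))%:E
    | phi in [set phi | C1c (Omega `*` Omega) phi /\
                        (supnorm (Omega `*` Omega) phi <= 1)%E]].

(* Elements of L^1 are represented by functions on the whole space; membership
   and norms only depend on their a.e. class on Omega. *)
Definition BV Omega : set ('rV[R]_N -> R) :=
  [set u | L1 Omega u /\ (TV Omega u < +oo)%E].

Definition NLBV Omega : set ('rV[R]_N -> R) :=
  [set u | L1 Omega u /\ (NLTV Omega u < +oo)%E].

Definition BVnorm Omega u : \bar R := (L1norm Omega u + TV Omega u)%E.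

Definition NLBVnorm Omega u : \bar R := (L1norm Omega u + NLTV Omega u)%E.

End BV.

(* Main.v *)
From HB Require Import structures.
Require Import Defs.
From mathcomp Require Import all_boot all_order all_algebra.
From mathcomp Require Import all_classical all_reals all_analysis.
From mathcomp Require Import measurable_realfun.
From mathcomp Require Import lra.

Set Implicit Arguments.
Unset Strict Implicit.
Unset Printing Implicit Defensive.
Import Order.TTheory GRing.Theory Num.Theory.
Import numFieldNormedType.Exports.
Local Open Scope classical_set_scope.
Local Open Scope ring_scope.

(** Both seminorms are suprema of pairings of u with divergences, so it suffices
    to turn test fields of one kind into test fields of the other.

    From nonlocal to local. Given phi on Omega x Omega, integrating
    phi (y, x) - phi (x, y) over y in Omega yields a compactly supported C^1
    field on Omega whose divergence is div1 phi (C1c_mutual_field,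
    div_mutual_field): this is differentiation under the integral sign,
    legitimate because phi is C^1 with compact support and Omega has finite
    measure (C1_Rintegral_slice). The field is bounded by a constant depending
    on the measure of Omega and the dimension, hence NLTV <= C TV (NLTV_le_TV).

    From local to nonlocal. Fix once and for all a C^1 cutoff eta, with values
    in [0, 1], compactly supported in Omega and of positive integral m
    (exists_cutoff, Rintegral_gt0). Given psi on Omega, the field
    phi (y, x) = eta y *: psi x is admissible and (div1_tensor)
      div1 phi = m div psi - sum_i (int psi_i) d_i eta.
    The last term is bounded independently of psi, so pairing with u gives
    TV <= a L1norm + b NLTV with a and b depending on Omega and eta alone
    (TV_le_NLTV). The equality of the spaces and the equivalence of the norms
    follow from these two inequalities. *)

(** * Borel sets of row vectors *)

Section borel_rV.
Context {R : realType} {n : nat}.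
Implicit Types (U : set 'rV[R]_n) (f : 'rV[R]_n -> R).

(** Rational boxes form a countable base of the product topology, and the
    sigma-algebra generated by the coordinates contains every box. *)
Lemma open_measurable_rV U : open U -> measurable U.
Proof.
move=> oU.
pose box (p : 'rV[rat]_n * nat) := [set v : 'rV[R]_n |
  forall i, ball (ratr (p.1 ord0 i) : R) p.2.+1%:R^-1 (v ord0 i)].
have -> : U = \bigcup_p (if `[< box p `<=` U >] then box p else set0).
  apply/seteqP; split=> [x Ux|x [p _]]; last first.
    by case: asboolP => [pU /pU|].
  have /nbhs_ballP[e /= e0 xeU] : nbhs x U by exact: open_nbhs_nbhs.
  have e2 : 0 < e / 2 by rewrite divr_gt0.
  have [k _ /(_ k (leqnn _))/=] := near_infty_natSinv_lt (PosNum e2).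
  have [d d0 dE] : exists2 d : R, 0 < d & d = k.+1%:R^-1.
    by exists k.+1%:R^-1; rewrite ?invr_gt0.
  rewrite -dE => ke.
  have /choice[q xq] (i : 'I_n) :
      exists q : rat, ball (ratr q : R) d (x ord0 i).
    have xi : x ord0 i - d < x ord0 i + d by lra.
    have [q] := rat_in_itvoo xi.
    rewrite in_itv /= => /andP[q1 q2]; exists q.
    by rewrite /ball/= ltr_norml; apply/andP; split; lra.
  exists (\row_i q i, k) => //.
  rewrite asboolT => [i|v vb]; first by rewrite mxE -dE.
  apply: xeU; split=> // i j; rewrite (ord1 i).
  apply: (@le_ball _ _ _ (d + d)); first lra.
  apply: (@ball_triangle _ R (ratr (q j))); first exact/ball_sym/xq.
  by have := vb j; rewrite /= mxE -dE.
apply: countable_bigcupT_measurable; first exact: countableP.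
move=> p; case: ifP => // _.
apply: (measurable_box (A := fun i => ball _ _)) => i.
by apply: open_measurable; apply: ball_open; rewrite /= invr_gt0 ltr0n.
Qed.

Lemma continuous_measurable_rV f : continuous f -> measurable_fun setT f.
Proof.
move=> /continuousP cf; apply: (measurability _ (RGenOpens.measurableE R)).
move=> _ [_ [a [b ->] <-]]; rewrite setTI; apply: open_measurable_rV.
exact/cf/interval_open.
Qed.

End borel_rV.

(** * Continuously differentiable maps *)

Section C1.
Context {R : realType}.
Implicit Types U V W : normedModType R.

(** The whole-space version of C1c: a test function extends by zero outside its
    support, so every point can be treated alike and no domain is carried. *)
Definition C1 V W (f : V -> W) :=
  (forall x, differentiable f x) /\ (forall v, continuous (fun x => 'D_v f x)).

(** Identifies the differential from an explicit first-order estimate; it serves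
    wherever the remainder is bounded by hand rather than by calculus rules. *)
Lemma differentiable_bound V W (f : V -> W) (x : V) (L : {linear V -> W}) :
  continuous L ->
  (forall e : R, 0 < e -> \forall h \near (0 : V),
    `|f (h + x) - f x - L h| <= e * `|h|) ->
  differentiable f x /\ forall v, 'D_v f x = L v.
Proof.
move=> cL Lf.
have fL : f \o shift x = cst (f x) + L +o_ 0 id.
  apply/eqaddoP => e e0; apply: filterS (Lf e e0) => h.
  by rewrite !fctE /= opprD addrA.
have dE := diff_unique cL fL.
have df : differentiable f x by apply/diff_locallyP; rewrite dE.
by split=> // v; rewrite deriveE// dE.
Qed.

Lemma C1_continuous V W (f : V -> W) : C1 f -> continuous f.
Proof. by move=> [df _] x; exact: differentiable_continuous. Qed.

Lemma C1_derivable V W (f : V -> W) x v : C1 f -> derivable f x v.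
Proof. by move=> [df _]; exact: diff_derivable. Qed.

Lemma nsuppt_near0 V W (f : V -> W) x :
  ~ suppt f x -> \forall y \near x, f y = 0.
Proof.
move=> xf; have : nbhs x (~` suppt f).
  apply: open_nbhs_nbhs; split=> //; exact/closed_openC/closed_closure.
apply: filterS => y yf; apply/eqP/negPn/negP => fy0; apply: yf.
exact: subset_closure.
Qed.

Lemma nsuppt_eq0 V W (f : V -> W) x : ~ suppt f x -> f x = 0.
Proof. by move=> /nsuppt_near0 /nbhs_singleton. Qed.

Lemma derive_near0 V W (f : V -> W) v x :
  (\forall y \near x, f y = 0) -> 'D_v f x = 0.
Proof.
by move=> f0; rewrite (@near_eq_derive _ _ _ f (cst 0)) ?derive_cst.
Qed.

(** Outside its support a test function vanishes on a neighbourhood. *)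
Lemma C1c_C1 V W (A : set V) (f : V -> W) : C1c A f -> C1 f.
Proof.
move=> [df cDf cf fA]; split=> [x|v x]; have [/fA Ax|/nsuppt_near0 f0] :=
  pselect (suppt f x); [exact: df| |exact: cDf|].
  suff [] : differentiable f x /\ forall v, 'D_v f x = (\0 : {linear V -> W}) v.
    by [].
  apply: differentiable_bound => [y|e e0]; first exact: cst_continuous.
  have : \forall h \near (0 : V), f (h + x) = 0.
    by move: f0; rewrite (near_shift 0) subr0.
  apply: filterS => h ->; rewrite (nbhs_singleton f0) !subrr normr0.
  by rewrite mulr_ge0// ltW.
rewrite /continuous_at (derive_near0 _ f0).
apply: (@cvg_trans _ (cst 0 @ nbhs x)); last exact: cvg_cst.
apply: near_eq_cvg; near=> y; rewrite derive_near0//.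
by near: y; exact: near_join.
Unshelve. all: by end_near. Qed.

(** Along a curve that moves affinely the two difference quotients coincide, so
    partial derivatives of a function on a product are directional derivatives
    of the function itself. *)
Lemma derive_comp_affine U V W (g : U -> V) (f : V -> W) a v w :
  (forall s : R, g (s *: v + a) = s *: w + g a) ->
  'D_v (f \o g) a = 'D_w f (g a).
Proof. by move=> gE; rewrite /derive /=; under eq_fun do rewrite gE. Qed.

Lemma derivable_comp_affine U V W (g : U -> V) (f : V -> W) a v w :
  (forall s : R, g (s *: v + a) = s *: w + g a) ->
  derivable f (g a) w -> derivable (f \o g) a v.
Proof.
move=> gE; rewrite /derivable /=.
by under [in X in _ -> X]eq_fun do rewrite gE.
Qed.

Lemma C1_comp_linear U V W (L : {linear U -> V}) (f : V -> W) :
  continuous L -> C1 f -> C1 (f \o L).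
Proof.
move=> cL [df cf]; split=> [x|v].
  by apply: differentiable_comp => //; exact: linear_differentiable.
have -> : (fun x => 'D_v (f \o L) x) = (fun x => 'D_(L v) f x) \o L.
  apply/funext => x; apply: derive_comp_affine => s.
  by rewrite linearD linearZ.
by move=> x; apply: continuous_comp; [exact: cL|exact: cf].
Qed.

Lemma C1_comp_fst U V W (f : U -> W) : C1 f -> C1 (fun p : U * V => f p.1).
Proof.
apply: (@C1_comp_linear _ _ _ (fst : {linear (U * V)%type -> U})) => p.
exact: cvg_fst.
Qed.

Lemma C1_comp_snd U V W (f : V -> W) : C1 f -> C1 (fun p : U * V => f p.2).
Proof.
apply: (@C1_comp_linear _ _ _ (snd : {linear (U * V)%type -> V})) => p.
exact: cvg_snd.
Qed.

Lemma C1_cst V W (w : W) : C1 (cst w : V -> W).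
Proof.
split=> // v; have -> : (fun x : V => 'D_v (cst w) x) = cst 0.
  by apply/funext => x; rewrite derive_cst.
by move=> x; exact: cvg_cst.
Qed.

Lemma C1_id V : C1 (id : V -> V).
Proof.
split=> [//|v]; have -> : (fun x : V => 'D_v id x) = cst v.
  by apply/funext => x; rewrite derive_id.
by move=> x; exact: cvg_cst.
Qed.

Lemma C1D V W (f g : V -> W) : C1 f -> C1 g -> C1 (f + g).
Proof.
move=> Cf Cg; have [df cf] := Cf; have [dg cg] := Cg; split=> [x|v].
  exact: differentiableD.
have -> : (fun x => 'D_v (f + g) x) = (fun x => 'D_v f x) + (fun x => 'D_v g x).
  by apply/funext => x; rewrite deriveD//; exact: C1_derivable.
by move=> x; apply: cvgD; [exact: cf|exact: cg].
Qed.

Lemma C1N V W (f : V -> W) : C1 f -> C1 (- f).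
Proof.
move=> Cf; have [df cf] := Cf; split=> [x|v]; first exact: differentiableN.
have -> : (fun x => 'D_v (- f) x) = - (fun x => 'D_v f x).
  by apply/funext => x; rewrite deriveN//; exact: C1_derivable.
by move=> x; apply: cvgN; exact: cf.
Qed.

Lemma C1Z V W (c : R) (f : V -> W) : C1 f -> C1 (c *: f).
Proof.
move=> Cf; have [df cf] := Cf; split=> [x|v]; first exact: differentiableZ.
have -> : (fun x => 'D_v (c *: f) x) = c *: (fun x => 'D_v f x).
  by apply/funext => x; rewrite deriveZ//; exact: C1_derivable.
by move=> x; apply: cvgZl_tmp; exact: cf.
Qed.

Lemma C1B V W (f g : V -> W) : C1 f -> C1 g -> C1 (f - g).
Proof. by move=> Cf Cg; apply: C1D => //; exact: C1N. Qed.

Lemma C1_sum V W n (f : 'I_n -> V -> W) :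
  (forall i, C1 (f i)) -> C1 (fun x => \sum_i f i x).
Proof.
move=> Cf; have -> : (fun x => \sum_i f i x) = \sum_i f i.
  by apply/funext => x; rewrite fct_sumE.
by elim/big_ind : _ => [|g h|i _]; [exact: C1_cst|exact: C1D|exact: Cf].
Qed.

Lemma C1M V (f g : V -> R) : C1 f -> C1 g -> C1 (f * g).
Proof.
move=> Cf Cg; have [df cf] := Cf; have [dg cg] := Cg; split=> [x|v].
  exact: differentiableM.
have -> : (fun x => 'D_v (f * g) x) =
    f * (fun x => 'D_v g x) + g * (fun x => 'D_v f x).
  apply/funext => x.
  have dfx : derivable f x v by exact: C1_derivable.
  have dgx : derivable g x v by exact: C1_derivable.
  by rewrite (deriveM dfx dgx).
have [cf0 cg0] := (C1_continuous Cf, C1_continuous Cg).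
by move=> x; exact: (cvgD (cvgM (cf0 x) (cg v x)) (cvgM (cg0 x) (cf v x))).
Qed.

Lemma C1Zl V W (k : V -> R) (w : W) : C1 k -> C1 (fun x => k x *: w).
Proof.
move=> Ck; have [dk ck] := Ck; split=> [x|v]; first exact: differentiableZl.
have -> : (fun x => 'D_v (fun z => k z *: w) x) = (fun x => 'D_v k x *: w).
  apply/funext => x; rewrite !deriveE//; last exact: differentiableZl.
  by rewrite diffZl.
by move=> x; apply: cvgZr_tmp; exact: ck.
Qed.

Lemma C1_row V n (f : V -> 'rV[R]_n) :
  (forall i, C1 (fun x => f x ord0 i : R)) -> C1 f.
Proof.
move=> Cf; have -> : f = fun x => \sum_i f x ord0 i *: delta_mx ord0 i.
  by apply/funext => x; exact: row_sum_delta.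
by apply: C1_sum => i; exact: C1Zl.
Qed.

Lemma derive_coord V n (f : V -> 'rV[R]_n) i x v : C1 f ->
  'D_v (fun x => f x ord0 i : R) x = ('D_v f x) ord0 i.
Proof. by move=> Cf; rewrite derive_mx ?mxE//; exact: C1_derivable. Qed.

Lemma C1_coord V n (f : V -> 'rV[R]_n) i :
  C1 f -> C1 (fun x => f x ord0 i : R).
Proof.
move=> Cf; have [df cf] := Cf; split=> [x|v].
  exact: (differentiable_comp (df x) (differentiable_coord _ _ _)).
under eq_fun do rewrite derive_coord//.
move=> x; apply: (@continuous_comp _ _ _ (fun y => 'D_v f y)
  (fun M : 'rV[R]_n => M ord0 i)); [exact: cf|exact: coord_continuous].
Qed.

End C1.

(** * Integration of compactly supported functions *)

Lemma compact_support_bounded {R : realType} {T : topologicalType} (f : T -> R)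
    (K : set T) : compact K -> continuous f -> (forall x, ~ K x -> f x = 0) ->
  exists2 M, 0 <= M & forall x, `|f x| <= M.
Proof.
move=> cK cf f0.
have : bounded_set (f @` K).
  exact/compact_bounded/continuous_compact/cK/continuous_subspaceT.
move=> [M [_ Mf]]; exists (`|M| + 1); first by rewrite addr_ge0.
move=> x; have [Kx|/f0 ->] := pselect (K x); last by rewrite normr0 addr_ge0.
apply: Mf; last by exists x.
by rewrite (le_lt_trans (ler_norm M))// ltrDl.
Qed.

(** The functions g below vanish when their first variable leaves a compact set:
    they can be integrated in that variable, and estimates are uniform in it. *)
Section slices.
Context {R : realType} {V : normedModType R}.
Variables (g : V * V -> R) (K : set V).
Hypotheses (cg : continuous g) (cK : compact K).
Hypothesis g0 : forall y x, ~ K y -> g (y, x) = 0.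

Lemma continuous_slice x : continuous (fun y => g (y, x)).
Proof.
move=> y; apply: (@continuous_comp _ _ _ (fun y => (y, x)) g); last exact: cg.
by apply: cvg_pair; [exact: cvg_id|exact: cvg_cst].
Qed.

(** Continuity at each (y, x) with y in K gives a product neighbourhood, and
    compactness of K makes the neighbourhood of x independent of y. *)
Lemma near_slice_le x e : 0 < e ->
  \forall x' \near x, forall y, `|g (y, x') - g (y, x)| <= e.
Proof.
move=> e0; have cov : \forall x' \near x,
    K `<=` [set y | `|g (y, x') - g (y, x)| <= e].
  apply: (proj1 (compact_near_coveringP K) cK _ _
    (fun x' y => `|g (y, x') - g (y, x)| <= e)) => y Ky.
  have e2 : 0 < e / 2 by rewrite divr_gt0.
  have /cvgrPdist_lt/(_ _ e2)[[B C]/= [yB xC] BC] := @cg (y, x).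
  exists (B, C) => // -[y' x'] [/= By' Cx'].
  have := BC (y', x') (conj By' Cx').
  have := BC (y', x) (conj By' (nbhs_singleton xC)).
  rewrite /= => h1 h2.
  rewrite (le_trans (ler_distD (g (y, x)) _ _))// [in leRHS](splitr e) lerD//.
    by rewrite distrC ltW.
  exact: ltW.
apply: filterS cov => x' Kx' y; have [/Kx'//|/g0 gy] := pselect (K y).
by rewrite !gy subrr normr0 ltW.
Qed.

End slices.

Section integral.
Context {R : realType} {n : nat}.
Notation V := 'rV[R]_n.
Notation mu := (lebesgue_rV R n).
Variable A : set V.
Hypotheses (mA : measurable A) (A_fin : (mu A < +oo)%E).
Implicit Types (f u : V -> R) (K : set V).

Lemma bounded_integrable f M : continuous f -> (forall x, `|f x| <= M) ->
  mu.-integrable A (EFin \o f).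
Proof.
move=> cf fM; apply: measurable_bounded_integrable => //.
  by apply: measurable_funTS; exact: continuous_measurable_rV.
exists M; split; first exact: num_real.
by move=> L ML x _; apply: (le_trans (fM x)); exact: ltW.
Qed.

Lemma cst_integrable (c : R) : mu.-integrable A (EFin \o cst c).
Proof.
by apply: (@bounded_integrable _ `|c|) => [x|x]; [exact: cst_continuous|].
Qed.

Lemma compact_support_integrable f K :
  compact K -> continuous f -> (forall x, ~ K x -> f x = 0) ->
  mu.-integrable A (EFin \o f).
Proof.
move=> cK cf f0; have [M _ fM] := compact_support_bounded cK cf f0.
exact: bounded_integrable cf fM.
Qed.

Lemma L1M_integrable u f M : L1 A u -> continuous f ->
  (forall x, `|f x| <= M) -> mu.-integrable A (EFin \o (fun x => u x * f x)).
Proof.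
move=> Lu cf fM; apply: (integrableMl mA Lu).
  by apply: measurable_funTS; exact: continuous_measurable_rV.
exists M; split; first exact: num_real.
by move=> L ML x _; apply: (le_trans (fM x)); exact: ltW.
Qed.

Lemma le_norm_Rintegral_cst f M : mu.-integrable A (EFin \o f) ->
  (forall x, A x -> `|f x| <= M) ->
  `|\int[mu]_(x in A) f x| <= M * fine (mu A).
Proof.
move=> fi fM; rewrite (le_trans (le_normr_Rintegral mA fi))//.
rewrite -Rintegral_cst//; apply: le_Rintegral => //.
- by have := integrable_norm fi; apply: eq_integrable.
- exact: cst_integrable.
Qed.

Let integrable_Rintegral_sum (I : Type) (r : seq I) (f : I -> V -> R) :
  (forall i, mu.-integrable A (EFin \o f i)) ->
  mu.-integrable A (EFin \o (fun x => \sum_(i <- r) f i x)) /\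
  \int[mu]_(x in A) (\sum_(i <- r) f i x) =
    \sum_(i <- r) \int[mu]_(x in A) f i x.
Proof.
move=> fi; elim: r => [|i r [IH1 IH2]].
  have e : (fun x => \sum_(j <- [::]) f j x) = cst 0.
    by apply/funext => x; rewrite big_nil.
  rewrite e big_nil Rintegral_cst// mul0r; split => //.
  exact: cst_integrable.
have e : (fun x => \sum_(j <- i :: r) f j x) =
    f i \+ (fun x => \sum_(j <- r) f j x).
  by apply/funext => x; rewrite big_cons.
rewrite e big_cons -IH2; split; last exact: RintegralD.
by have := integrableD mA (fi i) IH1; apply: eq_integrable.
Qed.

Lemma integrable_Rsum (I : finType) (f : I -> V -> R) :
  (forall i, mu.-integrable A (EFin \o f i)) ->
  mu.-integrable A (EFin \o (fun x => \sum_i f i x)).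
Proof. by move=> /(integrable_Rintegral_sum (index_enum I))[]. Qed.

Lemma Rintegral_sum (I : finType) (f : I -> V -> R) :
  (forall i, mu.-integrable A (EFin \o f i)) ->
  \int[mu]_(x in A) (\sum_i f i x) = \sum_i \int[mu]_(x in A) f i x.
Proof. by move=> /(integrable_Rintegral_sum (index_enum I))[]. Qed.

End integral.

(** * Integrals depending on a parameter *)

Lemma coord_le_norm {R : realType} {n : nat} (v : 'rV[R]_n) i :
  `|v ord0 i| <= `|v|.
Proof.
rewrite [leRHS]/Num.Def.normr /= mx_normrE.
exact: (le_bigmax _ (fun ij : 'I_1 * 'I_n => `|v ij.1 ij.2|) (ord0, i)).
Qed.

Section parametric_integral.
Context {R : realType} {n : nat}.
Notation V := 'rV[R]_n.
Notation mu := (lebesgue_rV R n).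
Variables (A : set V) (K : set V).
Hypotheses (mA : measurable A) (A_fin : (mu A < +oo)%E) (cK : compact K).

Section continuity.
Variable g : V * V -> R.
Hypotheses (cg : continuous g) (g0 : forall y x, ~ K y -> g (y, x) = 0).

Lemma slice_integrable x : mu.-integrable A (EFin \o (fun y => g (y, x))).
Proof.
apply: (compact_support_integrable mA A_fin cK) => [|y /g0//].
exact: continuous_slice.
Qed.

Lemma continuous_Rintegral_slice :
  continuous (fun x => \int[mu]_(y in A) g (y, x)).
Proof.
move=> x; apply/(@cvgrPdist_le _ _ _ (nbhs x)) => e e0.
have m0 : 0 <= fine (mu A) by rewrite fine_ge0.
have d0 : 0 < e / (fine (mu A) + 1) by rewrite divr_gt0// ltr_wpDl.
have := near_slice_le cg cK g0 x d0; apply: filterS => x' gx'.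
rewrite -RintegralB//; [|exact: slice_integrable..].
apply: (le_trans
  (le_norm_Rintegral_cst (M := e / (fine (mu A) + 1)) mA A_fin _ _)).
- have := integrableB mA (slice_integrable x) (slice_integrable x').
  exact: eq_integrable.
- by move=> y _; rewrite distrC; exact: gx'.
- by rewrite mulrAC ler_pdivrMr ?ltr_wpDl// ler_pM2l// lerDl.
Qed.

End continuity.

Section differentiability.
Variable F : V * V -> R.
Hypotheses (CF : C1 F) (F0 : forall y x, ~ K y -> F (y, x) = 0).

Let D i (p : V * V) := 'D_((0, delta_mx ord0 i) : V * V) F p.

Let DE i y x : 'D_(delta_mx ord0 i) (fun z => F (y, z)) x = D i (y, x).
Proof.
apply: (@derive_comp_affine _ _ _ _ (fun z => (y, z)) F) => s.
by congr pair; rewrite /= scaler0 add0r.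
Qed.

Let D0 i y x : ~ K y -> D i (y, x) = 0.
Proof.
move=> Ky; rewrite -DE (_ : (fun z => _) = cst 0) ?derive_cst//.
by apply/funext => z; exact: F0.
Qed.

Let cD i : continuous (D i).
Proof. exact: (proj2 CF). Qed.

Let derive_slice y x h :
  'D_((0, h) : V * V) F (y, x) = \sum_i h ord0 i * D i (y, x).
Proof.
have [dF _] := CF.
rewrite deriveE//.
rewrite (_ : (0, h) = \sum_i h ord0 i *: ((0, delta_mx ord0 i) : V * V)).
  by rewrite linear_sum; apply: eq_bigr => i _; rewrite linearZ /D deriveE.
rewrite [in LHS](row_sum_delta h).
elim/big_rec2 : _ => //= i p v _ <-.
by congr pair; rewrite /= scaler0 add0r.
Qed.

(** Mean value theorem on the segment from x to h + x: the derivative at the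
    intermediate point differs from the one at x by at most e per coordinate,
    uniformly in y. *)
Let taylor1 x e : 0 < e -> \forall h \near (0 : V), forall y,
  `|F (y, h + x) - F (y, x) - \sum_i h ord0 i * D i (y, x)| <= e * `|h| *+ n.
Proof.
move=> e0.
have : nbhs x (fun x' => forall i y, `|D i (y, x') - D i (y, x)| <= e).
  apply: (@filter_forall V 'I_n
    (fun i x' => forall y, `|D i (y, x') - D i (y, x)| <= e) (nbhs x)) => i.
  exact: (near_slice_le (@cD i) cK (@D0 i)).
move=> /nbhs_normP[r /= r0 Dr]; apply/nbhs_normP; exists r => //= h.
rewrite /= sub0r normrN => hr y.
pose f (t : R) := F (y, t *: h + x).
have df (t : R) : is_derive t (1 : R) f ('D_((0, h) : V * V) F (y, t *: h + x)).
  have gE (s : R) : (y, (s *: (1 : R) + t) *: h + x) =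
      s *: ((0, h) : V * V) + (y, t *: h + x).
    congr pair; rewrite /= ?scaler0 ?add0r//.
    by rewrite scalerDl addrA [s *: (1 : R)]mulr1.
  split.
    apply: (@derivable_comp_affine _ _ _ _
      (fun t : R => (y, t *: h + x)) F _ _ _ gE).
    exact: C1_derivable.
  exact: (@derive_comp_affine _ _ _ _
    (fun t : R => (y, t *: h + x)) F _ _ _ gE).
have [|c] := @MVT_segment R f _ 0 1 ler01 (fun t _ => df t).
  apply: continuous_subspaceT => t.
  by apply/differentiable_continuous/derivable1_diffP.
rewrite in_itv /= => /andP[c0 c1].
rewrite subr0 mulr1 /f scale1r scale0r add0r => ->.
rewrite derive_slice -sumrB (le_trans (ler_norm_sum _ _ _))//.
rewrite -[X in _ *+ X]card_ord -sumr_const; apply: ler_sum => i _.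
rewrite -mulrBr normrM mulrC ler_pM// ?coord_le_norm//; apply: Dr => /=.
rewrite opprD addrCA subrr addr0 normrN normrZ ger0_norm//.
by rewrite (le_lt_trans _ hr)// ler_piMl.
Qed.

Let G x := \int[mu]_(y in A) F (y, x).

(** Differentiation under the integral sign: the first-order remainder is
    uniformly small in y, hence its integral over a set of finite measure is
    small as well. *)
Let differentiable_G x : differentiable G x /\
  forall h, 'D_h G x = \sum_i h ord0 i * \int[mu]_(y in A) D i (y, x).
Proof.
pose L (h : V) : R := \sum_i h ord0 i * \int[mu]_(y in A) D i (y, x).
have L_lin : linear L.
  move=> a u v; rewrite /L scaler_sumr -big_split; apply: eq_bigr => i _ /=.
  by rewrite !mxE mulrDl -mulrA.
pose LM := GRing.isLinear.Build _ _ _ _ _ L_lin.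
pose LL : {linear V -> R} := HB.pack L LM.
apply: (@differentiable_bound _ _ _ G x LL).
  apply: (continuous_big (@add_continuous R)) => i _ h.
  have ci : (fun v : V => v ord0 i) v @[v --> h] --> h ord0 i.
    exact: coord_continuous.
  exact: (cvgMr_tmp ci).
move=> e e0; have m0 : 0 <= fine (mu A) by rewrite fine_ge0.
(* d |h| n is the bound of taylor1; integrated over A it must be at most e |h|,
   and the added 1 keeps the denominator positive. *)
pose d := e / (n%:R * fine (mu A) + 1).
have nm1 : 0 < n%:R * fine (mu A) + 1 by rewrite ltr_wpDl// mulr_ge0.
have d0 : 0 < d by rewrite divr_gt0.
have := taylor1 x d0; apply: filterS => h Fh.
have iD i : mu.-integrable A (EFin \o (fun y => D i (y, x))).
  exact: (slice_integrable (@cD i) (@D0 i)).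
have iF z : mu.-integrable A (EFin \o (fun y => F (y, z))).
  exact: (slice_integrable (C1_continuous CF) F0).
have iDh i : mu.-integrable A (EFin \o (fun y => h ord0 i * D i (y, x))).
  by have := integrableZl mA (h ord0 i) (iD i); apply: eq_integrable.
rewrite [LL h](_ : _ =
  \int[mu]_(y in A) (\sum_i h ord0 i * D i (y, x))); last first.
  rewrite (Rintegral_sum mA A_fin)//.
  by apply: eq_bigr => i _; rewrite RintegralZl.
have iFB : mu.-integrable A (EFin \o (fun y => F (y, h + x) - F (y, x))).
  by have := integrableB mA (iF (h + x)) (iF x); apply: eq_integrable.
have iS := integrable_Rsum mA A_fin iDh.
rewrite /G -RintegralB// -RintegralB//.
apply: (le_trans (le_norm_Rintegral_cst (M := d * `|h| *+ n) mA A_fin _ _)).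
- by have := integrableB mA iFB iS; apply: eq_integrable.
- by move=> y _; exact: Fh.
have -> : d * `|h| *+ n * fine (mu A) = d * (n%:R * fine (mu A)) * `|h|.
  by rewrite -mulr_natl; lra.
rewrite ler_wpM2r// /d mulrAC ler_pdivrMr// ler_pM2l//.
by rewrite lerDl.
Qed.

Lemma C1_Rintegral_slice : C1 G.
Proof.
split=> [x|v]; first by have [] := differentiable_G x.
under eq_fun do rewrite (differentiable_G _).2.
apply: (continuous_big (@add_continuous R)) => i _ h.
have cI := @continuous_Rintegral_slice _ (@cD i) (@D0 i) h.
exact: (cvgMl_tmp cI).
Qed.

Lemma derive_slice_integrable i x :
  mu.-integrable A
    (EFin \o (fun y => 'D_(delta_mx ord0 i) (fun z => F (y, z)) x)).
Proof.
under [X in EFin \o X]eq_fun do rewrite DE.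
exact: (slice_integrable (@cD i) (@D0 i)).
Qed.

Lemma derive_Rintegral_slice i x : 'D_(delta_mx ord0 i) G x =
  \int[mu]_(y in A) 'D_(delta_mx ord0 i) (fun z => F (y, z)) x.
Proof.
rewrite (differentiable_G x).2 (bigD1 i)//= big1 ?addr0 => [|j ji].
  by rewrite mxE !eqxx mul1r; apply: eq_Rintegral => y _; rewrite DE.
by rewrite mxE (negbTE ji) andbF mul0r.
Qed.

End differentiability.
End parametric_integral.

(** * Test fields and their divergence *)

Section test_functions.
Context {R : realType}.

(** Converse of C1c_C1: it suffices to vanish outside some compact part of U,
    which is easier to exhibit than the support. *)
Lemma C1_C1c (V W : normedModType R) (U K : set V) (f : V -> W) :
  C1 f -> compact K -> K `<=` U -> (forall x, ~ K x -> f x = 0) -> C1c U f.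
Proof.
move=> [df cf] cK KU f0.
have clK : closed K by apply: compact_closed => //; exact: norm_hausdorff.
have fK : suppt f `<=` K.
  rewrite [X in _ `<=` X](closure_id _).1//; apply: closureS => x /= /eqP fx0.
  by have [//|/f0] := pselect (K x).
split=> [x _|v x _||]; [exact: df|exact: cf| |exact: subset_trans KU].
by apply: subclosed_compact cK fK; exact: closed_closure.
Qed.

Context {n : nat}.
Notation V := 'rV[R]_n.
Notation mu := (lebesgue_rV R n).
Implicit Types (A : set V) (f : V -> V) (v : V).

Lemma enormZ a v : enorm (a *: v) = `|a| * enorm v.
Proof.
rewrite /enorm -sqrtr_sqr -sqrtrM ?sqr_ge0// mulr_sumr.
by congr Num.sqrt; apply: eq_bigr => i _; rewrite mxE exprMn.
Qed.

Lemma coord_le_enorm v i : `|v ord0 i| <= enorm v.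
Proof.
rewrite -sqrtr_sqr; apply: ler_wsqrtr; rewrite (bigD1 i)//= lerDl.
by apply: sumr_ge0 => j _; exact: sqr_ge0.
Qed.

Lemma enorm_le v M : (forall i, `|v ord0 i| <= M) ->
  enorm v <= Num.sqrt (M ^+ 2 *+ n).
Proof.
move=> vM; apply: ler_wsqrtr; rewrite -[X in _ *+ X]card_ord -sumr_const.
apply: ler_sum => i _; rewrite -real_normK ?num_real// lerXn2r ?nnegrE//.
exact: le_trans (vM i).
Qed.

Lemma supnormP (T : Type) (U : set T) (f : T -> V) (c : R) :
  (supnorm U f <= c%:E)%E <-> forall x, U x -> enorm (f x) <= c.
Proof.
split=> [fc x Ux|fc].
  by rewrite -lee_fin; apply: le_trans fc; apply: ereal_sup_ubound; exists x.
by apply: ub_ereal_sup => _ [x Ux <-]; rewrite lee_fin fc.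
Qed.

Lemma div_continuous f : C1 f -> continuous (div f).
Proof.
move=> Cf; apply: (continuous_big (@add_continuous R)) => i _.
exact: (C1_coord i Cf).2.
Qed.

Lemma div_nsuppt f x : ~ suppt f x -> div f x = 0.
Proof.
move=> /nsuppt_near0 f0; rewrite /div big1// => i _; apply: derive_near0.
by apply: filterS f0 => y ->; rewrite mxE.
Qed.

Lemma divZ c f x : C1 f -> div (c *: f) x = c * div f x.
Proof.
move=> Cf; rewrite /div mulr_sumr; apply: eq_bigr => i _.
have -> : (fun z => (c *: f) z ord0 i) = c *: (fun z => f z ord0 i : R).
  by apply/funext => z; rewrite fctE mxE.
by rewrite deriveZ//; exact/C1_derivable/C1_coord.
Qed.

Lemma Mdiv_integrable A (u : V -> R) f : measurable A -> L1 A u -> C1c A f ->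
  mu.-integrable A (EFin \o (fun x => u x * div f x)).
Proof.
move=> mA Lu Cf; have [_ _ cf _] := Cf; have cd := div_continuous (C1c_C1 Cf).
have [M _ fM] := compact_support_bounded cf cd (@div_nsuppt f).
exact: (L1M_integrable mA Lu cd fM).
Qed.

(** By homogeneity, a test field bounded by c instead of 1 costs a factor c. *)
Lemma le_TV A (u : V -> R) f c : measurable A -> L1 A u -> 0 < c ->
  C1c A f -> (forall x, A x -> enorm (f x) <= c) ->
  ((\int[mu]_(x in A) (u x * div f x))%:E <= c%:E * TV A u)%E.
Proof.
move=> mA Lu c0 Cf fc; have [_ _ cf fA] := Cf.
have Cf1 := C1c_C1 Cf.
rewrite -lee_pdivrMl//; apply: ereal_sup_ubound; exists (c^-1 *: f).
  split; last first.
    apply/supnormP => x Ax; rewrite enormZ gtr0_norm ?invr_gt0//.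
    by rewrite ler_pdivrMl// mulr1 fc.
  apply: (C1_C1c (C1Z _ Cf1) cf fA) => x /nsuppt_eq0 fx.
  by rewrite fctE fx scaler0.
rewrite -EFinM -(RintegralZl _ mA (Mdiv_integrable mA Lu Cf)); congr EFin.
by apply: eq_Rintegral => x _; rewrite divZ// mulrCA.
Qed.

End test_functions.

(** * Nonlocal variation bounded by total variation *)

Section NLTV_le_TV.
Context {R : realType} {n : nat}.
Notation V := 'rV[R]_n.
Notation mu := (lebesgue_rV R n).
Variable A : set V.
Hypotheses (mA : measurable A) (A_fin : (mu A < +oo)%E).

(** A nonlocal test field phi induces the ordinary field that integrates
    phi (y, x) - phi (x, y) over y. Its divergence is div1 phi, so testing
    against phi nonlocally is testing against this field locally. *)
Section mutual_field.
Variable phi : V * V -> V.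
Hypothesis Cphi : C1c (A `*` A) phi.

Let F i (p : V * V) : R := phi p ord0 i - phi (p.2, p.1) ord0 i.

Definition mutual_field (x : V) : V := \row_i \int[mu]_(y in A) F i (y, x).

(* Both projections, as phi occurs with its arguments in either order. *)
Let K := (fst @` suppt phi) `|` (snd @` suppt phi).

Let cK : compact K.
Proof.
have [_ _ cphi _] := Cphi; apply: compactU.
  apply: continuous_compact cphi; apply: continuous_subspaceT => p.
  exact: cvg_fst.
apply: continuous_compact cphi; apply: continuous_subspaceT => p.
exact: cvg_snd.
Qed.

Let KA : K `<=` A.
Proof.
by have [_ _ _ sA] := Cphi; move=> x [[p /sA[? ?] <-]|[p /sA[? ?] <-]].
Qed.

Let phi0l x y : ~ K x -> phi (x, y) = 0.
Proof.
by move=> Kx; apply: nsuppt_eq0 => xy; apply: Kx; left; exists (x, y).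
Qed.

Let phi0r x y : ~ K x -> phi (y, x) = 0.
Proof.
by move=> Kx; apply: nsuppt_eq0 => xy; apply: Kx; right; exists (y, x).
Qed.

Let CF i : C1 (F i).
Proof.
have Cp := C1c_C1 Cphi; have Cpi := C1_coord i Cp.
pose s (p : V * V) : V * V := (p.2, p.1).
have s_lin : linear s by move=> a [u v] [u' v'].
pose sM := GRing.isLinear.Build _ _ _ _ _ s_lin.
pose sL : {linear (V * V)%type -> (V * V)%type} := HB.pack s sM.
have cs : continuous sL by exact: swap_continuous.
exact: (C1B Cpi (C1_comp_linear cs Cpi)).
Qed.

Let F0 i y x : ~ K y -> F i (y, x) = 0.
Proof. by move=> Ky; rewrite /F /= phi0l// phi0r// mxE subrr. Qed.

Lemma C1c_mutual_field : C1c A mutual_field.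
Proof.
apply: (C1_C1c _ cK KA) => [|x Kx].
  apply: C1_row => i.
  rewrite (_ : (fun x => _) = fun x => \int[mu]_(y in A) F i (y, x)).
    exact: (C1_Rintegral_slice mA A_fin cK (CF i) (@F0 i)).
  by apply/funext => x; rewrite mxE.
apply/rowP => i; rewrite !mxE (@eq_Rintegral _ _ _ _ _ (cst 0)) => [|y _].
  by rewrite Rintegral_cst// mul0r.
by rewrite /F /= (phi0l _ Kx) (phi0r _ Kx) mxE subrr.
Qed.

Lemma div_mutual_field x : div mutual_field x = div1 A phi x.
Proof.
transitivity (\sum_i \int[mu]_(y in A)
    'D_(delta_mx ord0 i) (fun z => F i (y, z)) x).
  apply: eq_bigr => i _.
  rewrite -(derive_Rintegral_slice mA A_fin cK (CF i) (@F0 i)).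
  rewrite (_ : (fun z => mutual_field z ord0 i) =
    fun z => \int[mu]_(y in A) F i (y, z))//.
  by apply/funext => z; rewrite mxE.
have iDF i := derive_slice_integrable mA A_fin cK (CF i) (@F0 i) i x.
rewrite -(Rintegral_sum mA A_fin iDF).
apply: eq_Rintegral => y _; apply: eq_bigr => i _.
rewrite (_ : (fun z => (phi (y, z) - phi (z, y)) ord0 i) =
  fun z => F i (y, z))//.
by apply/funext => z; rewrite !mxE.
Qed.

(** Coordinates are estimated separately: the dimension enters the constant. *)
Lemma enorm_mutual_field x : (supnorm (A `*` A) phi <= 1)%E -> A x ->
  enorm (mutual_field x) <= Num.sqrt ((2 * fine (mu A)) ^+ 2 *+ n).
Proof.
move=> /supnormP phi1 Ax; apply: enorm_le => i; rewrite mxE.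
apply: le_norm_Rintegral_cst => //.
  exact: (slice_integrable mA A_fin cK (C1_continuous (CF i)) (@F0 i)).
move=> y Ay; rewrite (le_trans (ler_normB _ _))// [leRHS]mulr2n lerD//.
  by rewrite (le_trans (coord_le_enorm _ _))// phi1.
by rewrite (le_trans (coord_le_enorm _ _))// phi1.
Qed.

End mutual_field.

Lemma NLTV_le_TV u : L1 A u ->
  (NLTV A u <= (Num.sqrt ((2 * fine (mu A)) ^+ 2 *+ n) + 1)%:E * TV A u)%E.
Proof.
move=> Lu; apply: ub_ereal_sup => _ [phi [Cphi phi1] <-].
under eq_Rintegral do rewrite -div_mutual_field//.
have c0 : 0 < Num.sqrt ((2 * fine (mu A)) ^+ 2 *+ n) + 1.
  by rewrite ltr_wpDl ?sqrtr_ge0.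
apply: (le_TV mA Lu c0 (C1c_mutual_field Cphi)) => x Ax.
by rewrite (le_trans (enorm_mutual_field Cphi phi1 Ax))// lerDl.
Qed.

End NLTV_le_TV.

(** * Cutoff functions *)

Section bump.
Context {R : realType} {n : nat}.
Notation V := 'rV[R]_n.

(** Squaring smooths the corner of the positive part: this is C^1 and vanishes
    on the negative half-line, as a C^1 cutoff must. *)
Definition sqr_pos_part (t : R) : R := Num.max 0 t ^+ 2.

Lemma derive_sqr_pos_part t : differentiable sqr_pos_part t /\
  forall v, 'D_v sqr_pos_part t = 2 * Num.max 0 t * v.
Proof.
pose L (s : R) : R := 2 * Num.max 0 t * s.
have L_lin : linear L by move=> a u v; rewrite /L mulrDr mulrCA.
pose LM := GRing.isLinear.Build _ _ _ _ _ L_lin.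
pose LL : {linear R -> R} := HB.pack L LM.
apply: (@differentiable_bound _ _ _ sqr_pos_part t LL).
  exact: mulrl_continuous.
move=> e e0; apply/nbhs_normP; exists e => //= h.
rewrite /ball_ /= sub0r normrN => he.
have hh : h ^+ 2 <= e * `|h|.
  by rewrite -real_normK ?num_real// expr2 ler_wpM2r// ltW.
apply: le_trans hh; rewrite /L /sqr_pos_part ler_norml.
have [ht|ht] := leP 0 (h + t); have [t0|t0] := leP 0 t;
  by apply/andP; split; nra.
Qed.

Lemma C1_sqr_pos_part (f : V -> R) : C1 f -> C1 (sqr_pos_part \o f).
Proof.
move=> Cf; have [df cf] := Cf.
have dq t := (derive_sqr_pos_part t).1.
split=> [x|v]; first exact: differentiable_comp.
have -> : (fun x => 'D_v (sqr_pos_part \o f) x) =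
    fun x => 2 * Num.max 0 (f x) * 'D_v f x.
  apply/funext => x; rewrite deriveE; last exact: differentiable_comp.
  rewrite diff_comp// /comp -(deriveE _ (df x)) -(deriveE _ (dq (f x))).
  exact: (derive_sqr_pos_part _).2.
move=> x; have cm : {for x, continuous (fun x => Num.max 0 (f x))}.
  apply: (@continuous_comp _ _ _ f (fun t => Num.max 0 t)).
    exact: C1_continuous.
  by apply: continuous_max => //; exact: cvg_cst.
exact: (cvgM (cvgMl_tmp (a := 2) cm) (cf v x)).
Qed.

(** For r > 0, positive exactly on the open Euclidean ball of centre a and
    radius r. *)
Definition bump (a : V) (r : R) : V -> R :=
  sqr_pos_part \o (fun x => r ^+ 2 - \sum_i (x ord0 i - a ord0 i) ^+ 2).

Variables (a : V) (r : R).

Lemma C1_bump : C1 (bump a r).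
Proof.
apply: C1_sqr_pos_part.
have Ci i : C1 (fun x : V => x ord0 i - a ord0 i).
  have C1i : C1 (fun x : V => x ord0 i : R) by exact: (C1_coord i (@C1_id _ V)).
  have C1a : C1 (cst (a ord0 i) : V -> R) by exact: C1_cst.
  exact: (C1B C1i C1a).
have Cs : C1 (fun x : V => \sum_i (x ord0 i - a ord0 i) ^+ 2).
  by apply: C1_sum => i; exact: (C1M (Ci i) (Ci i)).
have Cr : C1 (cst (r ^+ 2) : V -> R) by exact: C1_cst.
exact: (C1B Cr Cs).
Qed.

Lemma bump_ge0 x : 0 <= bump a r x.
Proof. exact: sqr_ge0. Qed.

Lemma bump_le1 x : 0 <= r <= 1 -> bump a r x <= 1.
Proof.
move=> /andP[r0 r1]; rewrite /bump /= /sqr_pos_part.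
rewrite expr_le1// ?le_max ?lexx// ge_max ler01/=.
have : 0 <= \sum_i (x ord0 i - a ord0 i) ^+ 2.
  by apply: sumr_ge0 => i _; exact: sqr_ge0.
have : r ^+ 2 <= 1 by rewrite expr_le1.
lra.
Qed.

Lemma bump_center : 0 < r -> 0 < bump a r a.
Proof.
move=> r0; rewrite /bump /= big1 => [|i _]; last by rewrite subrr expr0n.
by rewrite subr0 /sqr_pos_part exprn_gt0// lt_max exprn_gt0// orbT.
Qed.

(** A closed ball of the max norm; it contains the Euclidean ball on which the
    bump lives, and its compactness is that of a product of segments. *)
Definition box : set V :=
  [set v | forall i, `[a ord0 i - r, a ord0 i + r]%classic (v ord0 i)].

Lemma compact_box : compact box.
Proof.
apply: (@rV_compact R n (fun i => `[a ord0 i - r, a ord0 i + r]%classic)) => i.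
exact: segment_compact.
Qed.

Lemma bump_box x : 0 <= r -> ~ box x -> bump a r x = 0.
Proof.
move=> r0 /existsNP[i]; rewrite /= in_itv /= => /negP xi.
rewrite /bump /= /sqr_pos_part max_l ?expr0n// subr_le0.
rewrite (bigD1 i)//= ler_wpDr//.
  by apply: sumr_ge0 => j _; exact: sqr_ge0.
rewrite -[leRHS]real_normK ?num_real// lerXn2r ?nnegrE// ltW// ltNge.
by apply: contra xi; rewrite ler_distl.
Qed.

End bump.

Section positive_integral.
Context {R : realType} {n : nat}.
Notation V := 'rV[R]_n.
Notation mu := (lebesgue_rV R n).

(** By continuity f exceeds half of f a on an open box around a, and open boxes
    have positive measure. *)
Lemma Rintegral_gt0 (A : set V) (f : V -> R) (a : V) : open A -> A a ->
  mu.-integrable A (EFin \o f) -> continuous f -> (forall x, 0 <= f x) ->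
  0 < f a -> 0 < \int[mu]_(x in A) f x.
Proof.
move=> oA Aa fi cf f0 fa.
have mA := open_measurable_rV oA.
have fa2 : f a / 2 < f a by lra.
have /nbhs_ballP[s /= s0 sA] : nbhs a (A `&` [set x | f a / 2 < f x]).
  apply: filterI; first exact: open_nbhs_nbhs.
    exact: (cvgr_gt (f a) (@cf a) _ fa2).
pose B : set V := [set v | forall i, ball (a ord0 i) s (v ord0 i)].
have BA : B `<=` A `&` [set x | f a / 2 < f x].
  by move=> v Bv; apply: sA; split=> // i j; rewrite (ord1 i).
have BsA : B `<=` A by move=> v /BA[].
have mball i : measurable (ball (a ord0 i : R) s).
  by apply: open_measurable; apply: ball_open.
have mB : measurable B by exact: (measurable_box mball).
have muB : (0 < mu B)%E.
  rewrite (lebesgue_rV_box mball); elim/big_ind : _ => //.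
    by move=> x y x0 y0; exact: mule_gt0.
  by move=> i _; rewrite lebesgue_measure_ball ?lte_fin ?pmulrn_lgt0// ltW.
have f0' : (0 < \int[mu]_(x in A) (f x)%:E)%E.
  have mf : measurable_fun A (EFin \o f) by case/integrableP : fi.
  apply: (@lt_le_trans _ _ (\int[mu]_(x in B) (f x)%:E)%E); last first.
    by apply: ge0_subset_integral => // x _; rewrite lee_fin.
  apply: (@lt_le_trans _ _ (\int[mu]_(x in B) (f a / 2)%:E)%E).
    by rewrite integral_cst// mule_gt0// lte_fin divr_gt0.
  apply: ge0_le_integral => //.
  - by move=> x _; rewrite lee_fin ltW// divr_gt0.
  - exact: measurable_funS mf.
  - by move=> x /BA[_ /ltW]; rewrite lee_fin.
rewrite /Rintegral fine_gt0// f0' /=.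
by rewrite ltey_eq (integrable_fin_num mA fi).
Qed.

End positive_integral.

(** * Total variation bounded by nonlocal variation *)

Section TV_le_NLTV.
Context {R : realType} {n : nat}.
Notation V := 'rV[R]_n.
Notation mu := (lebesgue_rV R n).

Lemma exists_cutoff (A : set V) : open A -> A !=set0 ->
  exists eta : V -> R, exists K : set V,
    [/\ C1 eta, compact K, K `<=` A, (forall x, ~ K x -> eta x = 0) &
      (forall x, 0 <= eta x <= 1) /\ (exists2 a, A a & 0 < eta a)].
Proof.
move=> oA [a Aa].
have /nbhs_ballP[e /= e0 eA] : nbhs a A by exact: open_nbhs_nbhs.
(* r at most 1 bounds the bump by 1; r < e keeps the closed box inside A. *)
pose r := Num.min 1 (e / 2).
have r0 : 0 < r by rewrite lt_min ltr01 divr_gt0.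
have r1 : r <= 1 by rewrite ge_min lexx.
have re : r < e by rewrite gt_min; apply/orP; right; lra.
exists (bump a r), (box a r); split.
- exact: C1_bump.
- exact: compact_box.
- move=> v vB; apply: eA; split=> // i j; rewrite (ord1 i).
  have := vB j; rewrite /= in_itv /= => vj.
  by rewrite /ball /= distrC (le_lt_trans _ re)// ler_distl.
- by move=> x; apply: bump_box; exact: ltW.
- split; last by exists a => //; exact: bump_center.
  by move=> x; rewrite bump_ge0 bump_le1// r1 ltW.
Qed.

Section tensor.
Variables (A K : set V) (eta : V -> R).
Hypotheses (mA : measurable A) (A_fin : (mu A < +oo)%E).
Hypotheses (Ceta : C1 eta) (cK : compact K) (KA : K `<=` A).
Hypotheses (eta0 : forall x, ~ K x -> eta x = 0).
Hypotheses (eta01 : forall x, 0 <= eta x <= 1).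

(** The nonlocal test field attached to psi: the cutoff localises the extra
    variable without affecting the derivatives in the other one. *)
Definition tensor (psi : V -> V) (p : V * V) : V := eta p.1 *: psi p.2.

Lemma C1c_tensor psi : C1c A psi -> C1c (A `*` A) (tensor psi).
Proof.
move=> Cpsi; have [_ _ cpsi psiA] := Cpsi; have Cp := C1c_C1 Cpsi.
apply: (C1_C1c (K := K `*` suppt psi)).
- apply: C1_row => i.
  rewrite (_ : (fun p => _) =
    (fun p : V * V => eta p.1) * (fun p : V * V => psi p.2 ord0 i)).
    exact: (C1M (C1_comp_fst V Ceta) (C1_comp_snd V (C1_coord i Cp))).
  by apply/funext => p; rewrite mxE.
- exact: compact_setX.
- by move=> p [/KA ? /psiA ?].
- move=> [y x] /not_andP[/eta0|/nsuppt_eq0] h; rewrite /tensor/= h.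
    by rewrite scale0r.
  by rewrite scaler0.
Qed.

Lemma supnorm_tensor psi : (supnorm A psi <= 1)%E ->
  (supnorm (A `*` A) (tensor psi) <= 1)%E.
Proof.
move=> /supnormP psi1; apply/supnormP => -[y x] [/= _ Ax].
have /andP[e0 e1] := eta01 y.
by rewrite /tensor enormZ /= ger0_norm// mulr_ile1 ?sqrtr_ge0 ?psi1.
Qed.

Let D i := 'D_(delta_mx ord0 i : V) eta.

Lemma div_tensor psi x y : C1 psi ->
  div (fun z => tensor psi (y, z) - tensor psi (z, y)) x =
  eta y * div psi x - \sum_i psi y ord0 i * D i x.
Proof.
move=> Cpsi; rewrite /div mulr_sumr -sumrB; apply: eq_bigr => i _.
have Ci := C1_coord i Cpsi.
rewrite (_ : (fun z => _) =
    eta y *: (fun z => psi z ord0 i : R) - psi y ord0 i *: eta); last first.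
  by apply/funext => z; rewrite !mxE [eta z * _]mulrC.
have d1 : derivable (fun z => psi z ord0 i : R) x (delta_mx ord0 i).
  exact: C1_derivable.
have d2 : derivable eta x (delta_mx ord0 i) by exact: C1_derivable.
have d3 := derivableZ (k := eta y) d1.
have d4 := derivableZ (k := psi y ord0 i) d2.
by rewrite (deriveB d3 d4) (deriveZ (eta y) d1) (deriveZ (psi y ord0 i) d2).
Qed.

(** Up to a positive factor div1 of the tensor field is div psi; the remainder
    only involves the fixed derivatives of the cutoff, not those of psi. *)
Lemma div1_tensor psi x : C1c A psi ->
  div1 A (tensor psi) x = (\int[mu]_(y in A) eta y) * div psi x -
    \sum_i (\int[mu]_(y in A) psi y ord0 i) * D i x.
Proof.
move=> Cpsi; have [_ _ cpsi psiA] := Cpsi; have Cp := C1c_C1 Cpsi.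
have ieta : mu.-integrable A (EFin \o eta).
  exact: (compact_support_integrable mA A_fin cK (C1_continuous Ceta) eta0).
have ipsi i : mu.-integrable A (EFin \o (fun y => psi y ord0 i)).
  apply: (compact_support_integrable mA A_fin cpsi
    (C1_continuous (C1_coord i Cp))).
  by move=> z /nsuppt_eq0 ->; rewrite mxE.
have ipsiD i : mu.-integrable A (EFin \o (fun y => psi y ord0 i * D i x)).
  by have := integrableZr mA (D i x) (ipsi i); apply: eq_integrable.
have ietad : mu.-integrable A (EFin \o (fun y => eta y * div psi x)).
  by have := integrableZr mA (div psi x) ieta; apply: eq_integrable.
transitivity (\int[mu]_(y in A)
    (eta y * div psi x - \sum_i psi y ord0 i * D i x)).
  by apply: eq_Rintegral => y _; exact: div_tensor.
rewrite RintegralB//; last exact: (integrable_Rsum mA A_fin ipsiD).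
rewrite RintegralZr// (Rintegral_sum mA A_fin ipsiD); congr (_ - _).
by apply: eq_bigr => i _; rewrite RintegralZr.
Qed.

Hypothesis eta_gt0 : 0 < \int[mu]_(y in A) eta y.

(** Solving div1_tensor for div psi and integrating against u bounds the local
    pairing by the nonlocal one plus a term in the L^1 norm of u. *)
Lemma TV_le_NLTV : exists a b : R, [/\ 0 <= a, 0 <= b & forall u, L1 A u ->
  (TV A u <= a%:E * L1norm A u + b%:E * NLTV A u)%E].
Proof.
pose m := \int[mu]_(y in A) eta y.
have /choice[M DM] i : exists M, 0 <= M /\ forall x, `|D i x| <= M.
  have [||M M0 DM] := @compact_support_bounded _ _ (D i) K cK; last by exists M.
    exact: Ceta.2.
  move=> x Kx; apply: derive_near0.
  have : nbhs x (~` K).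
    apply: open_nbhs_nbhs; split=> //; apply: closed_openC.
    by apply: compact_closed cK; exact: norm_hausdorff.
  by apply: filterS => y; exact: eta0.
have M0 i : 0 <= M i by have [] := DM i.
pose muA := fine (mu A).
have muA0 : 0 <= muA by rewrite fine_ge0.
have im0 : 0 <= m^-1 by rewrite invr_ge0 ltW.
exists (m^-1 * \sum_i muA * M i), m^-1; split=> //.
  by rewrite mulr_ge0// sumr_ge0// => i _; rewrite mulr_ge0.
move=> u Lu; apply: ub_ereal_sup => _ [psi [Cpsi psi1] <-].
have [_ _ cpsi psiA] := Cpsi; have Cp := C1c_C1 Cpsi.
have cD i : continuous (D i) by exact: Ceta.2.
have iuD i : mu.-integrable A (EFin \o (fun x => u x * D i x)).
  exact: (L1M_integrable mA Lu (cD i) (DM i).2).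
pose c i := \int[mu]_(y in A) psi y ord0 i.
have icuD i : mu.-integrable A (EFin \o (fun x => c i * (u x * D i x))).
  by have := integrableZl mA (c i) (iuD i); apply: eq_integrable.
have iud := Mdiv_integrable mA Lu Cpsi.
have imud : mu.-integrable A (EFin \o (fun x => m * (u x * div psi x))).
  by have := integrableZl mA m iud; apply: eq_integrable.
pose X := \int[mu]_(x in A) (u x * div1 A (tensor psi) x).
pose Y := \int[mu]_(x in A) (u x * div psi x).
pose Z i := \int[mu]_(x in A) (u x * D i x).
have XE : X = m * Y - \sum_i c i * Z i.
  transitivity (\int[mu]_(x in A)
      (m * (u x * div psi x) - \sum_i c i * (u x * D i x))).
    apply: eq_Rintegral => x _; rewrite div1_tensor// mulrBr mulrCA.
    congr (_ - _).
    by rewrite [LHS]mulr_sumr; apply: eq_bigr => i _; rewrite mulrCA.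
  rewrite RintegralB//; last exact: (integrable_Rsum mA A_fin icuD).
  rewrite RintegralZl// (Rintegral_sum mA A_fin icuD); congr (_ - _).
  by apply: eq_bigr => i _; rewrite RintegralZl.
have XN : (X%:E <= NLTV A u)%E.
  apply: ereal_sup_ubound; exists (tensor psi); last by [].
  by split; [exact: C1c_tensor|exact: supnorm_tensor].
have iu : mu.-integrable A (EFin \o (fun x => `|u x|)).
  by have := integrable_norm Lu; apply: eq_integrable.
pose l := \int[mu]_(x in A) `|u x|.
have lE : L1norm A u = l%:E by rewrite /l /Rintegral fineK// integrable_fin_num.
have cM i : `|c i| <= muA.
  rewrite -[muA]mul1r; apply: le_norm_Rintegral_cst => //.
    apply: (compact_support_integrable mA A_fin cpsi
    (C1_continuous (C1_coord i Cp))).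
    by move=> z /nsuppt_eq0 ->; rewrite mxE.
  move=> x Ax; apply: le_trans (coord_le_enorm _ _) _.
  by move/supnormP : psi1; apply.
have ZM i : `|Z i| <= M i * l.
  apply: (le_trans (le_normr_Rintegral mA (iuD i))).
  rewrite /l -RintegralZl//; apply: le_Rintegral => //.
  - by have := integrable_norm (iuD i); apply: eq_integrable.
  - by have := integrableZl mA (M i) iu; apply: eq_integrable.
  - by move=> x _; rewrite normrM mulrC ler_wpM2r// (DM i).2.
have S : \sum_i c i * Z i <= (\sum_i muA * M i) * l.
  rewrite mulr_suml; apply: ler_sum => i _; rewrite -mulrA.
  by rewrite (le_trans (ler_norm _))// normrM ler_pM.
have YE : Y = m^-1 * \sum_i c i * Z i + m^-1 * X.
  by rewrite XE -mulrDr addrC subrK mulKf// gt_eqF.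
rewrite -/Y YE lE EFinD; apply: leeD.
  by rewrite -EFinM lee_fin -mulrA ler_wpM2l.
by rewrite EFinM lee_wpmul2l// lee_fin.
Qed.

End tensor.
End TV_le_NLTV.

(** * Equivalence of the norms *)

Section total_variation_ge0.
Context {R : realType} {n : nat}.
Notation V := 'rV[R]_n.
Notation mu := (lebesgue_rV R n).
Variables (A : set V) (u : V -> R).

Lemma C1c0 (W1 W2 : normedModType R) (U : set W1) : C1c U (cst 0 : W1 -> W2).
Proof.
by apply: (@C1_C1c _ _ _ U set0) => //; [exact: C1_cst|exact: compact0].
Qed.

Lemma supnorm0 (T : Type) (U : set T) :
  (supnorm U (cst 0%R : T -> V) <= 1)%E.
Proof.
by apply/supnormP => x _; rewrite -(scale0r 0) enormZ normr0 mul0r.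
Qed.

Lemma div_eq0 (f : V -> V) x : (forall z, f z = 0) -> div f x = 0.
Proof.
move=> f0; apply: div_nsuppt.
rewrite /suppt (_ : [set _ | _] = set0) ?closure0//.
by apply/seteqP; split=> // z /=; rewrite f0 eqxx.
Qed.

Lemma TV_ge0 : (0 <= TV A u)%E.
Proof.
apply: ereal_sup_ubound; exists (cst 0).
  by split; [exact: C1c0|exact: supnorm0].
rewrite (@eq_Rintegral _ _ _ _ _ (cst 0)) => [|x _].
  by rewrite /Rintegral integral0.
by rewrite div_eq0// mulr0.
Qed.

Lemma NLTV_ge0 : (0 <= NLTV A u)%E.
Proof.
apply: ereal_sup_ubound; exists (cst 0).
  by split; [exact: C1c0|exact: supnorm0].
rewrite (@eq_Rintegral _ _ _ _ _ (cst 0)) => [|x _].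
  by rewrite /Rintegral integral0.
rewrite /div1 (@eq_Rintegral _ _ _ _ _ (cst 0)) => [|y _].
  by rewrite /Rintegral integral0 mulr0.
by rewrite div_eq0// => z; rewrite /cst subrr.
Qed.

End total_variation_ge0.

Theorem proposition3p3 (R : realType) (N : nat) (Omega : set 'rV[R]_N)
    (Omega_open : open Omega) (Omega_neq0 : Omega !=set0)
    (Omega_fin : (lebesgue_rV R N Omega < +oo)%E) :
  NLBV Omega = BV Omega /\
  exists c C : R, [/\ 0 < c, 0 < C &
    forall u, BV Omega u ->
      (c%:E * BVnorm Omega u <= NLBVnorm Omega u)%E /\
      (NLBVnorm Omega u <= C%:E * BVnorm Omega u)%E].
Proof.
have mO := open_measurable_rV Omega_open.
have [eta [K [Ceta cK KO eta0 [eta01 [z Oz etaz]]]]] :=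
  exists_cutoff Omega_open Omega_neq0.
have ieta :=
  compact_support_integrable mO Omega_fin cK (C1_continuous Ceta) eta0.
have eta_gt0 : 0 < \int[lebesgue_rV R N]_(y in Omega) eta y.
  apply: (Rintegral_gt0 Omega_open Oz ieta (C1_continuous Ceta) _ etaz) => x.
  by case/andP : (eta01 x).
have [a [b [a0 b0 TVle]]] :=
  TV_le_NLTV mO Omega_fin Ceta cK KO eta0 eta01 eta_gt0.
have [C C0 NLTVle] : exists2 C : R, 0 <= C &
    forall u, L1 Omega u -> (NLTV Omega u <= C%:E * TV Omega u)%E.
  exists (Num.sqrt ((2 * fine (lebesgue_rV R N Omega)) ^+ 2 *+ N) + 1).
    by rewrite addr_ge0// sqrtr_ge0.
  by move=> u; exact: NLTV_le_TV.
have L1_fin u : L1 Omega u -> L1norm Omega u \is a fin_num.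
  by move=> /integrable_norm/(integrable_fin_num mO).
have NLTV_fin u : L1 Omega u -> (TV Omega u < +oo)%E -> (NLTV Omega u < +oo)%E.
  by move=> Lu Tu; apply: (le_lt_trans (NLTVle u Lu)); exact: lte_mul_pinfty.
split.
  apply/seteqP; split=> u [Lu]; last by move=> Tu; split=> //; exact: NLTV_fin.
  move=> Nu; split=> //; apply: (le_lt_trans (TVle u Lu)).
  apply: lte_add_pinfty; last exact: lte_mul_pinfty.
  by apply: lte_mul_pinfty => //; rewrite ltey_eq L1_fin.
(* TV <= a L1 + b NLTV gives BVnorm <= (1 + a + b) NLBVnorm, and NLTV <= C TV
   gives NLBVnorm <= (1 + C) BVnorm; both use that the summands are >= 0. *)
exists (1 + a + b)^-1, (1 + C); split; [by rewrite invr_gt0; lra|lra|].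
move=> u [Lu Tu]; have Nu := NLTV_fin u Lu Tu.
have /fineK LE := L1_fin u Lu.
have L0 : (0 <= L1norm Omega u)%E by exact: integral_ge0.
have TE : TV Omega u = (fine (TV Omega u))%:E.
  by rewrite fineK// ge0_fin_numE// TV_ge0.
have NE : NLTV Omega u = (fine (NLTV Omega u))%:E.
  by rewrite fineK// ge0_fin_numE// NLTV_ge0.
have := NLTVle u Lu; have := TVle u Lu.
have := TV_ge0 Omega u; have := NLTV_ge0 Omega u; move: L0.
rewrite /BVnorm /NLBVnorm TE NE -LE.
set l := fine (L1norm _ _); set t := fine (TV _ _); set s := fine (NLTV _ _).
rewrite -!EFinM -!EFinD !lee_fin => l0 s0 t0 tle sle; split.
  by rewrite ler_pdivrMl; nra.
nra.
Qed.
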